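(* Consider the 3D pendulum model on $TSO(3)\cong SO(3)\times\mathbb{R}^3$ $$J\dot\omega = J\omega\times\omega + mg\,\rho\times R^{T}e_3,\qquad \dot R = R\widehat{\omega}.$$ Then the hanging equilibrium manifold $$\mathsf{H}=\Big\{(R,0)\in TSO(3): R^{T}e_3=\frac{\rho}{\|\rho\|}\Big\}$$ is stable in the sense of Lyapunov.
   Context: The 3D pendulum is a rigid body with a fixed frictionless pivot under uniform gravity. $R\in SO(3)$ is its attitude, $\omega\in\mathbb{R}^3$ its body-fixed angular velocity, $J$ its constant symmetric positive definite inertia matrix (body frame, origin at the pivot), $m>0$ its mass, $g>0$ the gravitational acceleration, $\rho\in\mathbb{R}^3$, $\rho\neq0$, the body-fixed vector from the pivot to the center of mass, $e_3=(0,0,1)^T$. For $a\in\mathbb{R}^3$, $\widehat a$ is the skew-symmetric matrix with $\widehat a\,b=a\times b$. $TSO(3)$ is identified with $SO(3)\times\mathbb{R}^3$ via $(R,R\widehat\omega)\leftrightarrow(R,\omega)$. A compact set $S$ of equilibria is stable in the sense of Lyapunov if for every neighborhood $U$ of $S$ there is a neighborhood $W$ of $S$ such that every solution starting in $W$ remains in $U$ for all $t\ge0$. *)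

(* Defs.v *)
From HB Require Import structures.
From mathcomp Require Import all_boot all_order all_algebra.
From mathcomp Require Import all_classical all_reals all_analysis.

Set Implicit Arguments.
Unset Strict Implicit.
Unset Printing Implicit Defensive.

Import Order.TTheory GRing.Theory Num.Theory.
Import numFieldNormedType.Exports.

Local Open Scope classical_set_scope.
Local Open Scope ring_scope.

Section Vectors3.
Context {R : realType}.
Implicit Types a b : 'cV[R]_3.

Definition e3 : 'cV[R]_3 := delta_mx ord_max 0.

(* The library norm of a matrix is the sup norm, hence this Euclidean one. *)
Definition enorm a : R := Num.sqrt (\sum_i a i 0 ^+ 2).

(* Indices are read in 'I_3 = Z/3Z:
   (a x b)_i = a_(i+1) b_(i+2) - a_(i+2) b_(i+1). *)
Definition cross a b : 'cV[R]_3 :=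
  \col_i (a (i + 1) 0 * b (i + 2) 0 - a (i + 2) 0 * b (i + 1) 0).

Definition hat a : 'M[R]_3 := \matrix_(i, j) cross a (delta_mx j 0) i 0.

Lemma hat_mulmx a b : hat a *m b = cross a b.
Proof.
have S (c : R) (k : 'I_3) :
    \sum_(j < 3) c * (delta_mx j 0 : 'cV[R]_3) k 0 * b j 0 = c * b k 0.
  rewrite (bigD1 k) //= !mxE !eqxx mulr1 big1 ?addr0 // => j /negPf.
  by rewrite !mxE eq_sym => ->; rewrite mulr0 mul0r.
apply/colP => i; rewrite mxE [in RHS]mxE -!S -sumrB.
by apply: eq_bigr => j _; rewrite !mxE mulrBl.
Qed.

Lemma tr_hat a : (hat a)^T = - hat a.
Proof.
apply/matrixP => i j; rewrite !mxE !andbT opprB.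
case: i => [[|[|[|//]]] ?]; case: j => [[|[|[|//]]] ?];
  rewrite -!val_eqE /= ?(mulr0, mulr1, subr0, sub0r, oppr0) //;
  do ?[congr (- _)]; congr (a _ _); exact: val_inj.
Qed.

Definition sym_posdef (J : 'M[R]_3) :=
  J^T = J /\ forall v : 'cV[R]_3, v != 0 -> 0 < (v^T *m J *m v) 0 0.

End Vectors3.
Arguments e3 : clear implicits.

Section Lyapunov.
Context {R : realType} {E : normedModType R}.

(* [X] is the state space, carrying the topology induced by [E];
   [sol T x] means that the restriction of [x] to [0, T) is a solution, where
   T <= +oo; the values of [x] outside [0, T) are irrelevant.  Solutions
   that are not known to exist for all t >= 0 are thus covered as well. *)
Definition lyapunov_stable (X : set E) (sol : \bar R -> (R -> E) -> Prop)
    (S : set E) :=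
  [/\ compact S,
      (forall p, S p -> sol +oo%E (cst p)) &
      forall U : set (subspace X), set_nbhs (S : set (subspace X)) U ->
        exists2 W : set (subspace X), set_nbhs (S : set (subspace X)) W &
          forall T x, sol T x -> W (x 0) ->
            forall t : R, 0 <= t -> (t%:E < T)%E -> U (x t)].

End Lyapunov.

Section Pendulum.
Context {R : realType}.

Definition SO3 : set 'M[R]_3 :=
  [set Q | Q^T *m Q = 1%:M /\ \det Q = 1].

(* (Q, w) stands for the tangent vector Q *m hat w at Q. *)
Definition TSO3 : set ('M[R]_3 * 'cV[R]_3) := SO3 `*` setT.

Definition hanging (rho : 'cV[R]_3) : set ('M[R]_3 * 'cV[R]_3) :=
  [set p | [/\ SO3 p.1, p.2 = 0 & p.1^T *m e3 R = (enorm rho)^-1 *: rho]].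

(* The equations are required on (0, T) and continuity on [0, T); since the
   right-hand sides are continuous, the equations then hold at t = 0 too, for
   the right derivatives. *)
Definition pendulum_solution (J : 'M[R]_3) (m g : R) (rho : 'cV[R]_3)
    (T : \bar R) (x : R -> 'M[R]_3 * 'cV[R]_3) :=
  let Q t := (x t).1 in
  let w t := (x t).2 in
  [/\ {within [set t | 0 <= t /\ (t%:E < T)%E], continuous x},
      (forall t : R, 0 <= t -> (t%:E < T)%E -> TSO3 (x t)) &
      forall t : R, 0 < t -> (t%:E < T)%E ->
        [/\ derivable w t 1, derivable Q t 1,
            J *m 'D_1 w t =
              cross (J *m w t) (w t)
              + (m * g) *: cross rho ((Q t)^T *m e3 R) &
            'D_1 Q t = Q t *m hat (w t)]].

End Pendulum.
Arguments TSO3 : clear implicits.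

(* Main.v *)
(** With [Gamma = R^T e3], [u = rho / |rho|] and [k = m g |rho|], the function
    [V = omega . J omega + k |Gamma - u|^2] is conserved: its derivative is
    [2 omega . (m g rho x Gamma) + 2 k omega . (Gamma x u) = 0], because
    [Gamma' = Gamma x omega].  It is nonnegative, it vanishes on [TSO(3)]
    exactly on the hanging manifold, and its sublevel sets are compact since
    [SO(3)] is compact and [J] is positive definite.  Hence every neighborhood
    of the hanging manifold contains a sublevel set of [V]. *)

Require Import Defs.
From mathcomp Require Import all_boot all_order all_algebra.
From mathcomp Require Import all_classical all_reals all_analysis.
From mathcomp Require Import ring lra.

Import Order.TTheory GRing.Theory Num.Theory.
Import numFieldNormedType.Exports.

Local Open Scope classical_set_scope.
Local Open Scope ring_scope.

(** * Lyapunov's direct method for a compact zero set *)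

(** Outside an open neighborhood of [S], the compact sublevel carries a positive minimum of [V];
    below that level lies a neighborhood of [S] that no solution leaves. *)
Lemma lyapunov_stable_sublevel (R : realType) (E : normedModType R) (X : set E)
    (sol : \bar R -> (R -> E) -> Prop) (S : set E) (V : E -> R) :
  continuous V ->
  compact (X `&` [set p | V p <= 1]) ->
  (forall p, X p -> 0 <= V p) ->
  S = X `&` [set p | V p = 0] ->
  (forall p, S p -> sol +oo%E (cst p)) ->
  (forall T x, sol T x -> forall t : R, 0 <= t -> (t%:E < T)%E ->
    X (x t) /\ V (x t) <= V (x 0)) ->
  lyapunov_stable X sol S.
Proof.
move=> cV cK V0 SE Ssol Vle; split=> //.
  have -> : S = (X `&` [set p | V p <= 1]) `&` V @^-1` [set y | y = 0].
    rewrite SE; apply/seteqP; split=> p /=; last by case=> [[]].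
    by case=> ? ->; rewrite ler01.
  apply: compact_closedI => //; apply: preimage_closed => // p _; exact: cV.
(* [C] is open only relative to [X]; the ambient open set [D] with the same trace on [X] keeps [K]
   compact. *)
move=> U /set_nbhsP[C [/open_subspaceP[D oD DX] SC CU]].
pose K := (X `&` [set p | V p <= 1]) `&` ~` D.
have cKD : compact K by apply: compact_closedI => //; exact: open_closedC.
have [d d0 dK] : exists2 d, 0 < d & forall p, X p -> V p < d -> D p.
  have [[p0 Kp0]|K0] := pselect (K !=set0); last first.
    (* With [K] empty, the whole sublevel at height 1 already lies in [D]. *)
    exists 1 => // p Xp Vp; apply: contrapT => nDp; apply: K0.
    by exists p; split=> //; split=> //; exact: ltW.
  have /(compact_EVT_min (ex_intro _ p0 Kp0) cKD)[c] : {within K, continuous V}.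
    exact: continuous_subspaceT.
  rewrite inE => -[[Xc Vc1] nDc] cmin; exists (V c).
    (* A zero minimum would put [c] in [S], hence in [D]. *)
    rewrite lt_neqAle V0// andbT; apply/negP => /eqP Vc; apply: nDc.
    have Cc : C c by apply: SC; rewrite SE.
    by have [] : (D `&` X) c by rewrite DX.
  move=> p Xp Vpc; apply: contrapT => nDp.
  suff : V c <= V p by rewrite leNgt Vpc.
  apply: cmin; rewrite inE; split=> //; split=> //=.
  exact: le_trans (ltW Vpc) Vc1.
exists [set p | V p < d].
  apply/set_nbhsP; exists [set p | V p < d]; split=> //.
    apply: open_subspaceW.
    by apply: (@open_comp _ _ V [set y | y < d]) => // p _; exact: cV.
  by rewrite SE => p [_ /= ->].
move=> T x /Vle xV /= Vx0 t t0 tT; have [Xt Vt] := xV t t0 tT.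
apply: CU; have [] // : (C `&` X) (x t).
by rewrite -DX; split=> //; apply: dK => //; exact: le_lt_trans Vt Vx0.
Qed.

(** * Two facts from analysis *)

Lemma derive0_within_cst (R : realType) (f : R -> R) (a b : R) : a <= b ->
  {within `[a, b], continuous f} ->
  (forall x, x \in `]a, b[%R -> is_derive x 1 f 0) -> f b = f a.
Proof.
move=> ab cf df; have [c _ /eqP] := MVT_segment ab df cf.
by rewrite mul0r subr_eq0 => /eqP.
Qed.

(** The box is the image under the continuous [vec_mx] of a product of segments. *)
Lemma compact_mx_bounded (R : realType) (m n : nat) (b : R) :
  compact [set M : 'M[R]_(m, n) | forall i j, `|M i j| <= b].
Proof.
have cvec : continuous (@vec_mx R m n).
  move=> v s /= /nbhs_ballP[e e0 es]; apply/nbhs_ballP.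
  exists e => //= w [_ vw]; apply: es; split=> // i j; rewrite !mxE; exact: vw.
have -> : [set M : 'M[R]_(m, n) | forall i j, `|M i j| <= b] =
    vec_mx @` [set v : 'rV[R]_(m * n) | forall i, `[- b, b]%classic (v ord0 i)].
  apply/seteqP; split=> [M Mb|_ [v vb] <- i j].
    exists (mxvec M); last exact: mxvecK.
    move=> k; case/mxvec_indexP: k => i j /=.
    by rewrite mxvecE in_itv/= -ler_norml.
  by rewrite mxE ler_norml; have := vb (mxvec_index i j); rewrite /= in_itv.
apply: continuous_compact; first exact: continuous_subspaceT.
apply: (@rV_compact _ _ (fun=> `[- b, b]%classic)) => i.
exact: segment_compact.
Qed.

(** * Algebra of the dot and cross products *)

Definition dot {R : realType} (a b : 'cV[R]_3) : R := \sum_i a i 0 * b i 0.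

Section Dot.
Context {R : realType}.
Implicit Types (a b c : 'cV[R]_3) (A : 'M[R]_3).

Lemma dotC a b : dot a b = dot b a.
Proof. by apply: eq_bigr => i _; rewrite mulrC. Qed.

Lemma dotDl a b c : dot (a + b) c = dot a c + dot b c.
Proof. by rewrite -big_split; apply: eq_bigr => i _; rewrite mxE mulrDl. Qed.

Lemma dotDr a b c : dot c (a + b) = dot c a + dot c b.
Proof. by rewrite dotC dotDl !(dotC c). Qed.

Lemma dotZl k a b : dot (k *: a) b = k * dot a b.
Proof. by rewrite mulr_sumr; apply: eq_bigr => i _; rewrite mxE mulrA. Qed.

Lemma dotZr k a b : dot a (k *: b) = k * dot a b.
Proof. by rewrite dotC dotZl dotC. Qed.

Lemma dotNl a b : dot (- a) b = - dot a b.
Proof. by rewrite -scaleN1r dotZl mulN1r. Qed.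

Lemma dotNr a b : dot a (- b) = - dot a b.
Proof. by rewrite dotC dotNl dotC. Qed.

Lemma dotE a b : dot a b = (a^T *m b) 0 0.
Proof. by rewrite mxE; apply: eq_bigr => i _; rewrite mxE. Qed.

Lemma dot_mulmx A a b : dot (A *m a) b = dot a (A^T *m b).
Proof. by rewrite !dotE trmx_mul mulmxA. Qed.

Lemma dot_ge0 a : 0 <= dot a a.
Proof. by apply: sumr_ge0 => i _; rewrite -expr2 sqr_ge0. Qed.

Lemma dot_eq0 a : (dot a a == 0) = (a == 0).
Proof.
apply/eqP/eqP => [a0|->]; last by apply: big1 => i _; rewrite mxE mul0r.
apply/colP => i; rewrite mxE; apply/eqP; rewrite -sqrf_eq0 expr2.
have /psumr_eq0P -> // : \sum_i a i 0 * a i 0 = 0 by [].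
by move=> j _; rewrite -expr2 sqr_ge0.
Qed.

Lemma dot_delta a (i : 'I_3) : dot a (delta_mx i 0) = a i 0.
Proof.
rewrite /dot (bigD1 i)//= mxE !eqxx mulr1 big1 ?addr0// => j ji.
by rewrite mxE (negPf ji) mulr0.
Qed.

Lemma dot_cross_cycle a b c : dot a (cross b c) = dot b (cross c a).
Proof.
(* Fixed names for the three indices let [ring] recognize equal coordinates, whatever form the index
   sums modulo 3 take. *)
pose i0 : 'I_3 := 0; pose i1 : 'I_3 := 1; pose i2 : 'I_3 := 2.
have dot3 (u v : 'cV[R]_3) :
    dot u v = u i0 0 * v i0 0 + u i1 0 * v i1 0 + u i2 0 * v i2 0.
  rewrite /dot !big_ord_recl big_ord0 addr0 addrA.
  by congr (u _ _ * v _ _ + u _ _ * v _ _ + u _ _ * v _ _); exact: val_inj.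
have cross0 (u v : 'cV[R]_3) :
    cross u v i0 0 = u i1 0 * v i2 0 - u i2 0 * v i1 0.
  by rewrite mxE; congr (u _ _ * v _ _ - u _ _ * v _ _); exact: val_inj.
have cross1 (u v : 'cV[R]_3) :
    cross u v i1 0 = u i2 0 * v i0 0 - u i0 0 * v i2 0.
  by rewrite mxE; congr (u _ _ * v _ _ - u _ _ * v _ _); exact: val_inj.
have cross2 (u v : 'cV[R]_3) :
    cross u v i2 0 = u i0 0 * v i1 0 - u i1 0 * v i0 0.
  by rewrite mxE; congr (u _ _ * v _ _ - u _ _ * v _ _); exact: val_inj.
by rewrite !dot3 !(cross0, cross1, cross2); ring.
Qed.

Lemma crossC a b : cross a b = - cross b a.
Proof. by apply/colP => i; rewrite !mxE opprB mulrC [X in _ - X]mulrC. Qed.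

Lemma crossZl k a b : cross (k *: a) b = k *: cross a b.
Proof. by apply/colP => i; rewrite !mxE mulrBr !mulrA. Qed.

Lemma crossvv a : cross a a = 0.
Proof. by apply/colP => i; rewrite !mxE mulrC subrr. Qed.

Lemma cross0v a : cross 0 a = 0.
Proof. by apply/colP => i; rewrite !mxE !mul0r subrr. Qed.

(** Two cyclic shifts lead to [dot b (cross a a)]. *)
Lemma dot_cross_idl a b : dot a (cross a b) = 0.
Proof.
by rewrite 2!dot_cross_cycle crossvv; apply: big1 => i _; rewrite mxE mulr0.
Qed.

End Dot.

(** * Positive definite quadratic forms *)

Lemma sym_posdef_ge0 {R : realType} {J : 'M[R]_3} (w : 'cV[R]_3) :
  sym_posdef J -> 0 <= dot w (J *m w).
Proof.
move=> [_ Jpos]; have [->|w0] := eqVneq w 0.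
  by rewrite dotE trmx0 mul0mx mxE.
by rewrite dotE mulmxA ltW// Jpos.
Qed.

(** With [p], [q], [r] the values of the form at [(v, v)], [(v, w)], [(w, w)], its value at
    [p w - q v] is [p (p r - q^2)], which is nonnegative; then divide by [p > 0]. *)
Lemma cauchy_schwarz_posdef {R : realType} {J : 'M[R]_3} (v w : 'cV[R]_3) :
  sym_posdef J ->
  dot v (J *m w) ^+ 2 <= dot v (J *m v) * dot w (J *m w).
Proof.
move=> J_pd; have [JT Jpos] := J_pd.
have [->|v0] := eqVneq v 0.
  by rewrite -(scale0r v) !dotZl !mul0r expr0n.
have Jv0 : 0 < dot v (J *m v) by rewrite dotE mulmxA Jpos.
have Jwv : dot w (J *m v) = dot v (J *m w) by rewrite dotC dot_mulmx JT.
have := sym_posdef_ge0 (dot v (J *m v) *: w + (- dot v (J *m w)) *: v) J_pd.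
rewrite mulmxDr -!scalemxAr !(dotDl, dotDr, dotZl, dotZr) Jwv.
set p := dot v _; set q := dot v _; set r := dot w _ => h.
have {}h : 0 <= p * (p * r - q ^+ 2) by move: h; congr (_ <= _); ring.
by rewrite -subr_ge0 -(pmulr_rge0 _ Jv0).
Qed.

Lemma sym_posdef_unitmx {R : realType} {J : 'M[R]_3} :
  sym_posdef J -> J \in unitmx.
Proof.
move=> [_ Jpos]; rewrite -row_free_unit -kermx_eq0; apply/rowV0P => v.
move=> /sub_kermxP vJ; apply/eqP; apply: contrapT => /negP v0.
have /Jpos : v^T != 0 by rewrite -trmx0 (inj_eq trmx_inj).
by rewrite trmxK vJ mul0mx mxE ltxx.
Qed.

(** Without eigenvalues: for [v i] the image of the [i]-th basis vector under the inverse of [J],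
    [w i 0] is [dot (v i) (J *m w)], and Cauchy-Schwarz for the form of [J] bounds it. *)
Lemma sym_posdef_coercive {R : realType} {J : 'M[R]_3} : sym_posdef J ->
  exists b : R, forall w, dot w (J *m w) <= 1 -> forall i, `|w i 0| <= b.
Proof.
move=> J_pd; have JU := sym_posdef_unitmx J_pd.
pose v i : 'cV[R]_3 := invmx J *m delta_mx i 0.
have Jv i : J *m v i = delta_mx i 0 by rewrite mulmxA mulmxV// mul1mx.
(* The sum [s] dominates every [w i 0 ^+ 2]; since [s <= (1 + s)^2], adding 1 avoids a square
   root. *)
exists (1 + \sum_i dot (v i) (J *m v i)) => w w1 i.
have vge0 j := sym_posdef_ge0 (v j) J_pd.
have vi : dot (v i) (J *m v i) <= \sum_i dot (v i) (J *m v i).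
  by rewrite (bigD1 i)//= lerDl sumr_ge0.
have := cauchy_schwarz_posdef (v i) w J_pd.
have -> : dot (v i) (J *m w) = w i 0.
  by rewrite dotC dot_mulmx J_pd.1 Jv dot_delta.
move: (vge0 i) vi w1; set s := \sum__ _; set c := dot (v i) _.
set z := dot w _ => c0 cs z1 h.
have {}h : w i 0 ^+ 2 <= c by apply: le_trans h _; rewrite ler_piMr.
rewrite ler_norml; apply/andP; split; nra.
Qed.

(** * Coordinatewise differentiation *)

Section DotDerive.
Context {R : realType}.
Implicit Types a b : R -> 'cV[R]_3.

Lemma is_derive_coord {m n : nat} {M : R -> 'M[R]_(m, n)} {t : R} i j :
  derivable M t 1 -> is_derive t 1 (fun s => M s i j) ('D_1 M t i j).
Proof.
move=> Mt; have /derivable_mxP/(_ i j) Mij := Mt.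
by apply: DeriveDef => //; rewrite derive_mx// mxE.
Qed.

Lemma is_derive_dot {a b} {t : R} {da db : 'cV[R]_3} :
  (forall i, is_derive t 1 (fun s => a s i 0) (da i 0)) ->
  (forall i, is_derive t 1 (fun s => b s i 0) (db i 0)) ->
  is_derive t 1 (fun s => dot (a s) (b s)) (dot da (b t) + dot (a t) db).
Proof.
move=> Da Db.
have -> : (fun s => dot (a s) (b s)) =
    \sum_i ((fun s => a s i 0) * (fun s => b s i 0)).
  by apply/funext => s; rewrite fct_sumE.
apply: is_derive_eq; rewrite -big_split; apply: eq_bigr => i _ /=.
by rewrite addrC; congr (_ + _); exact: mulrC.
Qed.

Lemma is_derive_mulmx (A : 'M[R]_3) {a} {t : R} {da : 'cV[R]_3} i :
  (forall j, is_derive t 1 (fun s => a s j 0) (da j 0)) ->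
  is_derive t 1 (fun s => (A *m a s) i 0) ((A *m da) i 0).
Proof.
move=> Da.
have -> : (fun s => (A *m a s) i 0) = \sum_j (A i j \*: (fun s => a s j 0)).
  by apply/funext => s; rewrite mxE fct_sumE.
by apply: is_derive_eq; rewrite mxE.
Qed.

End DotDerive.

Lemma tr_mulmx_e3 {R : realType} (Q : 'M[R]_3) i :
  (Q^T *m e3 R) i 0 = Q ord_max i.
Proof. by rewrite -colE !mxE. Qed.

(** * The energy function and its compact sublevels *)

Section Energy.
Context {R : realType}.
Implicit Types (J : 'M[R]_3) (k : R) (u : 'cV[R]_3).

(* Twice the mechanical energy relative to the hanging equilibrium when
   [u = rho / |rho|] and [k = m g |rho|]: for unit vectors
   [|Gamma - u|^2 = 2 (1 - Gamma . u)]. *)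
Definition energy J k u (p : 'M[R]_3 * 'cV[R]_3) : R :=
  dot p.2 (J *m p.2) + k * dot (p.1^T *m e3 R - u) (p.1^T *m e3 R - u).

Lemma continuous_fst_coord i j :
  continuous (fun p : 'M[R]_3 * 'cV[R]_3 => p.1 i j).
Proof.
move=> p; apply: (@continuous_comp _ _ _ fst (fun M : 'M[R]_3 => M i j)).
  exact: cvg_fst.
exact: coord_continuous.
Qed.

Lemma continuous_snd_coord i :
  continuous (fun p : 'M[R]_3 * 'cV[R]_3 => p.2 i 0).
Proof.
move=> p; apply: (@continuous_comp _ _ _ snd (fun v : 'cV[R]_3 => v i 0)).
  exact: cvg_snd.
exact: coord_continuous.
Qed.

Lemma continuous_dot (T : topologicalType) (a b : T -> 'cV[R]_3) :
  (forall i, continuous (fun p => a p i 0)) ->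
  (forall i, continuous (fun p => b p i 0)) ->
  continuous (fun p => dot (a p) (b p)).
Proof.
move=> ca cb; apply: continuous_big => [|i _]; first exact: add_continuous.
by move=> p; apply: continuousM; [exact: ca|exact: cb].
Qed.

Lemma continuous_energy J k u : continuous (energy J k u).
Proof.
have cG i : continuous (fun p : 'M[R]_3 * 'cV[R]_3 => (p.1^T *m e3 R - u) i 0).
  under eq_fun do rewrite mxE tr_mulmx_e3 mxE.
  move=> p; apply: continuousB; first exact: continuous_fst_coord.
  exact: cst_continuous.
move=> p; apply: (@continuousD _ _ _ (fun q => dot q.2 (J *m q.2))).
  apply: continuous_dot => i; first exact: continuous_snd_coord.
  under eq_fun do rewrite mxE.
  apply: continuous_big => [|j _]; first exact: add_continuous.
  move=> q; apply: continuousM; first exact: cst_continuous.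
  exact: continuous_snd_coord.
apply: continuousM; first exact: cst_continuous.
exact: continuous_dot.
Qed.

Lemma energy_ge0 J k u p : sym_posdef J -> 0 <= k -> 0 <= energy J k u p.
Proof.
by move=> J_pd k0; rewrite addr_ge0 ?sym_posdef_ge0// mulr_ge0// dot_ge0.
Qed.

Lemma energy_eq0 J k u p : sym_posdef J -> 0 < k ->
  energy J k u p = 0 -> p.2 = 0 /\ p.1^T *m e3 R = u.
Proof.
move=> J_pd k0 /eqP; rewrite /energy paddr_eq0 ?sym_posdef_ge0//; last first.
  by rewrite mulr_ge0 ?dot_ge0// ltW.
rewrite mulf_eq0 (gt_eqF k0)/= dot_eq0 subr_eq0 => /andP[w0 /eqP ->].
split=> //.
apply/eqP; apply: contraTT w0 => w0; have := J_pd.2 _ w0.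
by rewrite dotE mulmxA => /gt_eqF ->.
Qed.

(** The columns of an orthogonal matrix are unit vectors. *)
Lemma SO3_entry_le1 (Q : 'M[R]_3) i j : SO3 Q -> `|Q i j| <= 1.
Proof.
move=> [QQ _]; have : \sum_k Q k j ^+ 2 = 1.
  transitivity ((Q^T *m Q) j j); last by rewrite QQ mxE eqxx.
  by rewrite mxE; apply: eq_bigr => k _; rewrite mxE expr2.
rewrite (bigD1 i)//= => Q1.
rewrite -(@ler_pXn2r _ 2)// ?nnegrE// expr1n real_normK ?num_real// -Q1 lerDl.
by apply: sumr_ge0 => k _; exact: sqr_ge0.
Qed.

(** The set is cut out by polynomial equations in the entries. *)
Lemma closed_TSO3 : closed (TSO3 R).
Proof.
have closed_fiber (f : 'M[R]_3 * 'cV[R]_3 -> R) c :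
    continuous f -> closed [set p | f p = c].
  by move=> cont_f; apply: (@preimage_closed _ _ f [set y | y = c]) => //.
have -> : TSO3 R =
    (\bigcap_(ij in [set: 'I_3 * 'I_3])
      [set p : 'M[R]_3 * 'cV[R]_3 | \sum_k p.1 k ij.1 * p.1 k ij.2
        = (ij.1 == ij.2)%:R]) `&`
    [set p | \det p.1 = 1].
  apply/seteqP; split=> [[Q w] [[/= QQ Q1] _]|[Q w] [/= QQ Q1]].
    split=> // -[i j] _ /=.
    have := congr1 (fun M : 'M[R]_3 => M i j) QQ; rewrite !mxE => <-.
    by apply: eq_bigr => k _; rewrite mxE.
  split=> //; split=> //=; apply/matrixP => i j; rewrite !mxE -(QQ (i, j))//.
  by apply: eq_bigr => k _; rewrite mxE.
apply: closedI.
  apply: closed_bigI => -[i j] _ /=; apply: closed_fiber.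
  apply: continuous_big => [|k _]; first exact: add_continuous.
  by move=> p; apply: continuousM; exact: continuous_fst_coord.
(* The determinant is treated through its Leibniz expansion, a sum over permutations [s]. *)
apply: closed_fiber; apply: continuous_big => [|s _].
  exact: add_continuous.
move=> p; apply: (@continuousM _ _ (cst _)); first exact: cst_continuous.
apply: continuous_big => [|i _]; first exact: mul_continuous.
exact: continuous_fst_coord.
Qed.

(** The potential term being nonnegative, the kinetic term is at most 1, so coercivity bounds the
    velocity; the attitude has entries bounded by 1. *)
Lemma compact_energy_sublevel J k u : sym_posdef J -> 0 <= k ->
  compact (TSO3 R `&` [set p | energy J k u p <= 1]).
Proof.
move=> J_pd k0; have [b wb] := sym_posdef_coercive J_pd.
apply: (subclosed_compact _
  (compact_setX (compact_mx_bounded R 3 3 1) (compact_mx_bounded R 3 1 b))).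
  apply: closedI; first exact: closed_TSO3.
  apply: (@preimage_closed _ _ (energy J k u) [set y | y <= 1]) => // p _.
  exact: continuous_energy.
move=> [Q w] [[/= SQ _] E1]; split=> /= i j; first exact: SO3_entry_le1.
rewrite ord1; apply: wb; apply: le_trans E1.
by rewrite /energy lerDl mulr_ge0// dot_ge0.
Qed.

End Energy.

(** * Energy along solutions, and equilibria *)

Section Solutions.
Context {R : realType}.
Variables (J : 'M[R]_3) (m g : R) (rho : 'cV[R]_3) (k : R) (u : 'cV[R]_3).

Lemma is_derive_energy T x (t : R) :
  k *: u = (m * g) *: rho -> sym_posdef J -> pendulum_solution J m g rho T x ->
  0 < t -> (t%:E < T)%E -> is_derive t 1 (energy J k u \o x) 0.
Proof.
move=> ku J_pd [_ _ xeq] t0 tT; have [Dw DQ Ew EQ] := xeq t t0 tT.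
set w := (x t).2 in Dw Ew EQ *; set G := (x t).1^T *m e3 R in Ew.
set dw := 'D_1 (fun s => (x s).2) t in Ew.
(* From [Q' = Q *m hat w] and the skew symmetry of [hat w]: the transpose of [Q'] sends [e3] to
   [- hat w *m G]. *)
pose dG : 'cV[R]_3 := - cross w G.
have wD i : is_derive t 1 (fun s => (x s).2 i 0) (dw i 0).
  exact: is_derive_coord.
have GD i : is_derive t 1 (fun s => ((x s).1^T *m e3 R - u) i 0) (dG i 0).
  have -> : (fun s => ((x s).1^T *m e3 R - u) i 0) =
      (fun s => (x s).1 ord_max i) - cst (u i 0).
    by apply/funext => s; rewrite mxE tr_mulmx_e3 mxE.
  have := is_derive_coord ord_max i DQ; rewrite EQ => QD.
  apply: is_derive_eq; rewrite subr0 -tr_mulmx_e3 trmx_mul tr_hat -mulmxA.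
  by rewrite mulNmx hat_mulmx.
have := is_derive_dot wD (fun i => is_derive_mulmx J i wD).
have := is_derive_dot GD GD => D2 D1.
have -> : energy J k u \o x = (fun s => dot (x s).2 (J *m (x s).2)) +
  k \*: (fun s => dot ((x s).1^T *m e3 R - u) ((x s).1^T *m e3 R - u)) by [].
apply: is_derive_eq; rewrite -/w -/G.
(* The gyroscopic term is orthogonal to [w], so only gravity does work. *)
have JwE : dot w (J *m dw) = k * dot w (cross u G).
  rewrite Ew dotDr crossC dotNr dot_cross_idl oppr0 add0r.
  by rewrite -crossZl -ku crossZl dotZr.
(* [G] is orthogonal to [dG]; only [u] contributes, with the sign that cancels the power of
   gravity. *)
have dGE : dot (G - u) dG = - dot w (cross u G).
  rewrite dotNr dotDl dotNl crossC dotNr dot_cross_idl oppr0 add0r.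
  by rewrite dotNr !opprK dot_cross_cycle (dot_cross_cycle _ w) crossC dotNr.
have -> : dot dw (J *m w) = dot w (J *m dw) by rewrite dotC dot_mulmx J_pd.1.
rewrite [dot dG _]dotC dGE JwE /GRing.scale /=; ring.
Qed.

(** The derivative vanishes on the open interval only; continuity of [x] at 0 brings in the initial
    time. *)
Lemma energy_conserved T x (t : R) :
  k *: u = (m * g) *: rho -> sym_posdef J -> pendulum_solution J m g rho T x ->
  0 <= t -> (t%:E < T)%E -> energy J k u (x t) = energy J k u (x 0).
Proof.
move=> ku J_pd xsol t0 tT.
apply: (@derive0_within_cst _ (energy J k u \o x)) => //.
  have [cx _ _] := xsol.
  have {}cx : {within `[0, t], continuous x}.
    apply: continuous_subspaceW cx => s /=; rewrite in_itv/= => /andP[s0 st].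
    by split=> //; apply: le_lt_trans tT; rewrite lee_fin.
  move=> s; apply: (@continuous_comp (subspace `[0, t]%classic)).
    exact: cx.
  exact: continuous_energy.
move=> s; rewrite in_itv/= => /andP[s0 st].
by apply: (is_derive_energy T) => //; apply: lt_trans tT; rewrite lte_fin.
Qed.

(** The vertical direction in the body frame is parallel to [rho], so gravity has no torque; all
    other terms vanish with the velocity. *)
Lemma hanging_equilibrium p : hanging rho p ->
  pendulum_solution J m g rho +oo%E (cst p).
Proof.
move=> [SO3p p0 Gp]; split=> [|//|t _ _].
- exact/continuous_subspaceT/cst_continuous.
- rewrite /= p0 !derive_cst.
  split; [exact: derivable_cst|exact: derivable_cst| |].
    rewrite Gp !mulmx0 cross0v add0r [cross rho _]crossC crossZl crossvv.
    by rewrite scaler0 oppr0 scaler0.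
  apply/matrixP => i j; rewrite !mxE big1// => l _.
  by rewrite mxE cross0v mxE mulr0.
Qed.

End Solutions.

Theorem proposition2 (R : realType) (J : 'M[R]_3) (m g : R) (rho : 'cV[R]_3) :
  sym_posdef J -> 0 < m -> 0 < g -> rho != 0 ->
  lyapunov_stable (TSO3 R) (pendulum_solution J m g rho) (hanging rho).
Proof.
move=> J_pd m0 g0 rho0.
have rho_gt0 : 0 < enorm rho.
  rewrite sqrtr_gt0 lt_neqAle sumr_ge0 ?andbT; last first.
    by move=> i _; exact: sqr_ge0.
  by rewrite eq_sym -[X in X == _]/(dot rho rho) dot_eq0.
(* The norm in [k] cancels the one in [u], so [cross (k *: u) G] is exactly the torque of
   gravity. *)
pose u := (enorm rho)^-1 *: rho; pose k := m * g * enorm rho.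
have k0 : 0 < k by rewrite !mulr_gt0.
have ku : k *: u = (m * g) *: rho by rewrite scalerA mulfK// gt_eqF.
apply: (@lyapunov_stable_sublevel _ _ _ _ _ (energy J k u)).
- exact: continuous_energy.
- exact: compact_energy_sublevel (ltW k0).
- by move=> p _; exact: energy_ge0 (ltW k0).
- apply/seteqP; split=> [p [SO3p p0 Gp]|p [[SO3p _] /= p0]].
    split=> //=; have dot00 : dot 0 0 = 0 :> R by apply/eqP; rewrite dot_eq0.
    by rewrite /energy p0 Gp subrr mulmx0 dot00 mulr0 addr0.
  by have [] := energy_eq0 J k u p J_pd k0 p0.
- exact: hanging_equilibrium.
move=> T x xsol t t0 tT; split; first by have [_ xX _] := xsol; exact: xX.
by rewrite (energy_conserved J m g rho k u T).
Qed.
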